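(* Let $f\in C(I,I)$ be null. Then for every finite open cover $\mathcal U$ of $I$, $p^*_{I,\mathcal U}(n)$ is of polynomial order: there exist constants $C>0$ and $q\in\mathbb N$ (depending only on $\mathcal U$) such that $p^*_{I,\mathcal U}(n)\le C\,n^q$ for all $n\ge1$.
   Context: $I=[0,1]$, $C(I,I)$ continuous self-maps of $I$. For a finite open cover $\mathcal U$, $N(\mathcal U)$ is the minimal cardinality of a subcover and $\bigvee$ denotes common refinement. For $A=\{t_1<t_2<\cdots\}\subset\mathbb Z_+$, $h_A(f,\mathcal U)=\limsup_{n\to\infty}\frac1n\log N(\bigvee_{i=1}^nf^{-t_i}\mathcal U)$ and $h_A(f)=\sup_{\mathcal U}h_A(f,\mathcal U)$; $f$ is null if $\sup_Ah_A(f)=0$. The maximal pattern complexity is $p^*_{I,\mathcal U}(n)=\max_{0\le t_1<\cdots<t_n}N\big(\bigvee_{i=1}^nf^{-t_i}\mathcal U\big)$. *)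

(* Defs.v *)
From Stdlib Require Import Reals Lra Lia List Classical ClassicalEpsilon.
Open Scope R_scope.

Definition I (x : R) : Prop := 0 <= x <= 1.

Definition in_CII (f : R -> R) : Prop :=
  (forall x, I x -> I (f x)) /\
  (forall x, I x -> forall eps, 0 < eps -> exists d, 0 < d /\
     forall y, I y -> Rabs (y - x) < d -> Rabs (f y - f x) < eps).

Definition openI (W : R -> Prop) : Prop :=
  forall x, I x -> W x -> exists eps, 0 < eps /\
    forall y, I y -> Rabs (y - x) < eps -> W y.

Definition open_cover (k : nat) (U : nat -> R -> Prop) : Prop :=
  (forall j, (j < k)%nat -> openI (U j)) /\
  (forall x, I x -> exists j, (j < k)%nat /\ U j x).

Definition subcover {J : Type} (P : J -> Prop) (V : J -> R -> Prop)
  (S : list J) : Prop :=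
  (forall j, In j S -> P j) /\
  (forall x, I x -> exists j, In j S /\ V j x).

Definition has_subcover_le {J : Type} (P : J -> Prop) (V : J -> R -> Prop)
  (m : nat) : Prop :=
  exists S, subcover P V S /\ (length S <= m)%nat.

Definition Ncov {J : Type} (P : J -> Prop) (V : J -> R -> Prop) : nat :=
  epsilon (inhabits 0%nat)
    (fun m => has_subcover_le P V m /\
       forall m', has_subcover_le P V m' -> (m <= m')%nat).

Definition iter (f : R -> R) (t : nat) : R -> R := fun x => Nat.iter t f x.

(* Index set of the join  \/_{i=1}^n f^{-t_i} U : choices g with g i < k
   for i < n; the corresponding element is
   {x in I | forall i < n, f^{t_i}(x) in U (g i)}. *)
Definition join_idx (k n : nat) (g : nat -> nat) : Prop :=
  forall i, (i < n)%nat -> (g i < k)%nat.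

Definition join_set (f : R -> R) (U : nat -> R -> Prop) (t : nat -> nat)
  (n : nat) (g : nat -> nat) : R -> Prop :=
  fun x => I x /\ forall i, (i < n)%nat -> U (g i) (iter f (t i) x).

(* N( \/_{i=1}^n f^{-t_i} U ), with t_1,...,t_n = t 0, ..., t (n-1). *)
Definition Njoin (f : R -> R) (k : nat) (U : nat -> R -> Prop)
  (t : nat -> nat) (n : nat) : nat :=
  Ncov (join_idx k n) (join_set f U t n).

Definition incr_upto (t : nat -> nat) (n : nat) : Prop :=
  forall i, (S i < n)%nat -> (t i < t (S i))%nat.

Definition pstar (f : R -> R) (k : nat) (U : nat -> R -> Prop) (n : nat) : nat :=
  epsilon (inhabits 0%nat)
    (fun m => (exists t, incr_upto t n /\ Njoin f k U t n = m) /\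
       forall t, incr_upto t n -> (Njoin f k U t n <= m)%nat).

Definition is_limsup (a : nat -> R) (L : R) : Prop :=
  (forall eps, 0 < eps -> exists N, forall n, (N <= n)%nat -> a n < L + eps) /\
  (forall eps, 0 < eps -> forall N, exists n, (N <= n)%nat /\ L - eps < a n).

(* A = {t_1 < t_2 < ...} infinite subset of Z_+, given by an increasing
   enumeration t (t_i = t (i-1)). *)
Definition strictly_incr (t : nat -> nat) : Prop :=
  forall i, (t i < t (S i))%nat.

Definition hA_is (f : R -> R) (t : nat -> nat) (k : nat)
  (U : nat -> R -> Prop) (r : R) : Prop :=
  is_limsup (fun n => ln (INR (Njoin f k U t n)) / INR n) r.

(* f is null: sup_A h_A(f) = sup_A sup_U h_A(f,U) = 0; since every
   h_A(f,U) >= 0 this means h_A(f,U) = 0 for all A and all U. *)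
Definition null (f : R -> R) : Prop :=
  forall t k U, strictly_incr t -> open_cover k U -> hA_is f t k U 0.

(* Main.v *)
Require Import Defs.
From Stdlib Require Import Reals Lra Lia List Arith Sorted FinFun Classical ClassicalEpsilon.
Open Scope R_scope.

(** Nullness bounds, for every [u < v], the size of a set of times along which all patterns of being [<= u] or [>= v] occur, so by Sauer-Shelah only polynomially many patterns occur among orbits that avoid the gap [(u,v)].  A gap is harmless once the points inside it have finitely many future itineraries relative to it: an orbit is then described by a gap-avoiding word up to its first visit and one of these futures afterwards.  Every interval contains such a gap: either a wandering interval, whose images stay on one side of it, or else periodic points are dense; in that case, for lack of horseshoes, some iterate of [f] is the identity on a subinterval.  Finally, a supremum argument over [z] combines finitely many gaps into polynomially many names for all of [I]. *)

(** * Iteration, continuity, and the Sauer-Shelah lemma *)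

Lemma iter_add F m n x : iter F (m + n) x = iter F m (iter F n x).
Proof.
  unfold iter; induction m as [|m IH]; simpl; [reflexivity | now rewrite IH].
Qed.

Lemma iter_iter F N n x : iter (iter F N) n x = iter F (n * N) x.
Proof.
  induction n as [|n IH]; [reflexivity|].
  change (iter F N (iter (iter F N) n x) = iter F (N + n * N) x).
  now rewrite IH, iter_add.
Qed.

Lemma iter_fixed F n x : F x = x -> iter F n x = x.
Proof.
  intros H; unfold iter; induction n as [|n IH]; simpl; [reflexivity | now rewrite IH].
Qed.

Lemma iter_opp F n x : iter (fun y => - F (- y)) n x = - iter F n (- x).
Proof.
  unfold iter; induction n as [|n IH]; simpl; [ring|].
  rewrite IH, Ropp_involutive; reflexivity.
Qed.

Lemma iter_continuity F n : continuity F -> continuity (iter F n).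
Proof.
  intros HF; induction n as [|n IH].
  - exact (derivable_continuous _ derivable_id).
  - exact (continuity_comp (iter F n) F IH HF).
Qed.

Lemma opp_conj_continuity F : continuity F -> continuity (fun y => - F (- y)).
Proof.
  intros HF.
  apply (continuity_opp (fun y => F (- y))).
  apply (continuity_comp (fun y => - y) F); [|exact HF].
  apply (continuity_opp (fun y => y)), (derivable_continuous _ derivable_id).
Qed.

Lemma continuity_eps g x eps : continuity g -> 0 < eps ->
  exists d, 0 < d /\ forall y, Rabs (y - x) < d -> Rabs (g y - g x) < eps.
Proof.
  intros Hg Heps; destruct (Hg x eps Heps) as (d & Hd & H).
  exists d; split; [exact Hd|]; intros y Hy.
  destruct (Req_dec y x) as [->|Hne].
  - now rewrite Rminus_diag, Rabs_R0.
  - apply H; split; [split; [exact Logic.I | auto] | exact Hy].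
Qed.

Lemma intermediate_value g a b y : continuity g -> a <= b ->
  (g a <= y <= g b \/ g b <= y <= g a) -> exists z, a <= z <= b /\ g z = y.
Proof.
  intros Hg Hab Hy.
  destruct (IVT_cor (fun z => g z - y) a b) as (z & Hz & Hz0).
  - apply (continuity_minus g (fun _ => y)); [exact Hg|].
    apply continuity_const; intros ? ?; reflexivity.
  - exact Hab.
  - destruct Hy; nra.
  - exists z; split; [exact Hz | lra].
Qed.

Lemma Forall2_map_l {A B C} (h : A -> B) (P : B -> C -> Prop) l w :
  Forall2 P (map h l) w <-> Forall2 (fun a c => P (h a) c) l w.
Proof.
  revert w; induction l as [|a l IH]; intros w; simpl.
  - split; intros H; inversion H; constructor.
  - split; intros H; inversion H; subst; constructor; try apply IH; auto.
Qed.

Lemma Forall2_map_r {A B C} (h : A -> B) (P : C -> B -> Prop) l w :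
  Forall2 P w (map h l) <-> Forall2 (fun c a => P c (h a)) w l.
Proof.
  revert w; induction l as [|a l IH]; intros w; simpl.
  - split; intros H; inversion H; constructor.
  - split; intros H; inversion H; subst; constructor; try apply IH; auto.
Qed.

Lemma Forall2_nth_iff {A B} (P : A -> B -> Prop) (a : A) (b : B) l w :
  Forall2 P l w <->
  length l = length w /\ forall i, (i < length l)%nat -> P (nth i l a) (nth i w b).
Proof.
  revert w; induction l as [|x l IH]; intros [|y w]; simpl.
  - split; [split; [auto | lia] | constructor].
  - split; [intros H; inversion H | intros [H _]; discriminate].
  - split; [intros H; inversion H | intros [H _]; discriminate].
  - split.
    + intros H; inversion H; subst; apply IH in H5 as [H1 H2]; split; [lia|].
      intros [|i] Hi; [assumption | apply H2; lia].
    + intros [H1 H2]; constructor; [apply (H2 0%nat); lia|].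
      apply IH; split; [lia|]; intros i Hi; apply (H2 (S i)); lia.
Qed.

Fixpoint words (n : nat) : list (list bool) :=
  match n with
  | O => nil :: nil
  | S n => map (cons false) (words n) ++ map (cons true) (words n)
  end.

Lemma words_length n : length (words n) = (2 ^ n)%nat.
Proof.
  induction n as [|n IH]; simpl; [reflexivity|].
  rewrite length_app, !length_map; lia.
Qed.

Lemma in_words n w : In w (words n) <-> length w = n.
Proof.
  revert w; induction n as [|n IH]; intros w; simpl.
  - split; [intros [<-|[]]; reflexivity | destruct w; [auto | discriminate]].
  - rewrite in_app_iff, !in_map_iff; split.
    + intros [(v & <- & H)|(v & <- & H)]; apply IH in H; simpl; lia.
    + destruct w as [|[] w]; [discriminate| |]; simpl; intros H;
        [right | left]; exists w; rewrite IH; split; auto; lia.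
Qed.

Lemma words_NoDup n : NoDup (words n).
Proof.
  induction n as [|n IH]; simpl.
  - constructor; [intros [] | constructor].
  - apply NoDup_app.
    + apply Injective_map_NoDup; [intros ? ? H; now injection H | exact IH].
    + apply Injective_map_NoDup; [intros ? ? H; now injection H | exact IH].
    + intros w H1 H2; apply in_map_iff in H1 as (w1 & <- & _).
      apply in_map_iff in H2 as (w2 & H & _); discriminate.
Qed.

(** Induction on [ts], splitting off the first letter: words with some extension in [W] are treated
    at [d+1], words with both extensions at [d], and (m+1)^(d+1) + (m+1)^d <= (m+2)^(d+1). The
    clause over all [P] encodes that [w] is the restriction of [w'] to [ss] without naming
    positions. *)
Lemma sauer_shelah (ts : list nat) (d : nat) (W : list bool -> Prop) :
  (exists S, (forall w, length w = length ts -> W w -> In w S) /\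
     (length S <= (length ts + 1) ^ d)%nat) \/
  (exists ss, length ss = d /\ incl ss ts /\
     (StronglySorted lt ts -> StronglySorted lt ss) /\
     forall w, length w = d -> exists w', length w' = length ts /\ W w' /\
       forall P : nat -> bool -> Prop, Forall2 P ts w' -> Forall2 P ss w).
Proof.
  revert d W; induction ts as [|t ts IH]; intros [|d] W.
  - destruct (classic (W nil)) as [H|H].
    + right; exists nil; repeat split; auto using incl_refl.
      intros [|] Hw; [exists nil; auto | discriminate].
    + left; exists nil; split; [intros [|] ?; [auto | discriminate] | simpl; lia].
  - left; exists (nil :: nil); split.
    + intros [|] H; [simpl; auto | discriminate].
    + simpl length; rewrite Nat.add_0_l, Nat.pow_1_l; lia.
  - destruct (classic (exists w, length w = length (t :: ts) /\ W w)) as [(w' & H1 & H2)|H].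
    + right; exists nil; repeat split; [intros ? [] | constructor |].
      intros [|] Hw; [|discriminate]; exists w'; repeat split; auto.
    + left; exists nil; split; [|simpl; lia].
      intros w H1 H2; apply H; exists w; auto.
  - destruct (IH (S d) (fun w => exists b, W (b :: w))) as [(S1 & HS1 & L1)|(ss & H1 & H2 & H3 & H4)].
    2:{ right; exists ss; split; [exact H1|]; split; [intros a Ha; right; auto|]; split.
        - intros H; apply StronglySorted_inv in H as [H _]; auto.
        - intros w Hw; destruct (H4 w Hw) as (w' & Hw1 & (b & Hb) & Hw2).
          exists (b :: w'); simpl; repeat split; [lia | exact Hb|].
          intros P HP; inversion HP; auto. }
    destruct (IH d (fun w => W (false :: w) /\ W (true :: w)))
      as [(S2 & HS2 & L2)|(ss & H1 & H2 & H3 & H4)].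
    2:{ right; exists (t :: ss); split; [simpl; lia|].
        split; [intros a [<-|Ha]; [left; reflexivity | right; auto]|]; split.
        - intros H; apply StronglySorted_inv in H as [H H'].
          constructor; [auto|]; rewrite Forall_forall in *; auto.
        - intros [|b w] Hw; [discriminate|].
          destruct (H4 w) as (w' & Hw1 & (Hf & Ht) & Hw2); [simpl in Hw; lia|].
          exists (b :: w'); simpl; repeat split; [lia | destruct b; auto|].
          intros P HP; inversion HP; constructor; auto. }
    left.
    (* A word of [S1] gets the letter [false] if that puts it in [W], and [true] otherwise; [S2]
       supplies the [true] extension when both are possible. *)
    exists (map (fun w => (if excluded_middle_informative (W (false :: w))
                           then false else true) :: w) S1 ++ map (cons true) S2).
    split.
    + intros [|b w] Hw HW; [discriminate|]; simpl in Hw.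
      assert (In w S1) by (apply HS1; [lia | exists b; exact HW]).
      apply in_app_iff.
      destruct (classic (W (false :: w))) as [Hf|Hf].
      * destruct b.
        -- right; apply in_map, HS2; [lia | auto].
        -- left; apply in_map_iff; exists w; split; [|assumption].
           destruct excluded_middle_informative; [reflexivity | contradiction].
      * destruct b; [|contradiction].
        left; apply in_map_iff; exists w; split; [|assumption].
        destruct excluded_middle_informative; [contradiction | reflexivity].
    + rewrite length_app, !length_map; simpl length.
      set (m := length ts) in *.
      assert ((m + 1) ^ d <= (m + 2) ^ d)%nat by (apply Nat.pow_le_mono_l; lia).
      replace (S m + 1)%nat with (m + 2)%nat by lia; simpl in *; nia.
Qed.

(** * Independence sets *)

(** Combinatorial independence of the half-lines (-oo,u] and [v,+oo) along the times [ss]. *)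
Definition indep (F : R -> R) (u v : R) (ss : list nat) : Prop :=
  forall w : list bool, length w = length ss -> exists x,
    Forall2 (fun t b => if b : bool then v <= iter F t x else iter F t x <= u) ss w.

(** One forbidden size excludes all larger ones, since dropping initial times preserves
    independence. *)
Definition bounded_indep (F : R -> R) : Prop :=
  forall u v, u < v -> exists D, forall ss,
    StronglySorted lt ss -> length ss = D -> ~ indep F u v ss.

(** Reflection exchanges the two half-lines, hence the negated word. It lets later arguments treat a
    single direction of motion. *)
Lemma bounded_indep_opp F :
  bounded_indep F -> bounded_indep (fun y => - F (- y)).
Proof.
  intros H u v Huv; destruct (H (- v) (- u)) as (D & HD); [lra|].
  exists D; intros ss Hs Hl Hi; apply (HD ss Hs Hl).
  intros w Hw; destruct (Hi (map negb w)) as (x & Hx); [now rewrite length_map|].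
  exists (- x); apply Forall2_map_r in Hx; revert Hx; apply Forall2_impl.
  intros t [] Ht; simpl in Ht; rewrite iter_opp in Ht; lra.
Qed.

(** The times 0, m, 2m, ... would be independent: the point found for the tail of a word is pulled
    back into the left or the right piece, as the first letter demands. *)
Lemma no_horseshoe F m a alpha beta b : bounded_indep F -> (1 <= m)%nat ->
  a <= alpha -> alpha < beta -> beta <= b ->
  (forall y, a <= y <= b -> exists x, a <= x <= alpha /\ iter F m x = y) ->
  (forall y, a <= y <= b -> exists x, beta <= x <= b /\ iter F m x = y) -> False.
Proof.
  intros HF Hm Ha Hab Hb HA HB; destruct (HF alpha beta Hab) as (D & HD).
  apply (HD (map (fun i => i * m)%nat (seq 0 D))).
  - clear HD; generalize 0%nat as j; induction D as [|D IH]; intros j; simpl; constructor.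
    + apply IH.
    + apply Forall_forall; intros t Ht; apply in_map_iff in Ht as (i & <- & Hi).
      apply in_seq in Hi; nia.
  - now rewrite length_map, length_seq.
  - intros w Hw; rewrite length_map, length_seq in Hw; subst D; clear HD.
    (* Keeping the point in [[a,b]] is what allows the next pull-back. *)
    enough (exists x, a <= x <= b /\ Forall2 (fun t c =>
      if c : bool then beta <= iter F t x else iter F t x <= alpha)
      (map (fun i => i * m)%nat (seq 0 (length w))) w) as (x & _ & Hx) by eauto.
    induction w as [|c w (y & Hy & IH)]; simpl.
    + exists a; split; [lra | constructor].
    + assert (exists x, a <= x <= b /\ (if c then beta <= x else x <= alpha) /\
                iter F m x = y) as (x & Hx & Hc & Hxy).
      { destruct c; [destruct (HB y Hy) as (x & Hx & E) | destruct (HA y Hy) as (x & Hx & E)];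
          exists x; repeat split; lra || assumption. }
      exists x; split; [exact Hx|]; constructor; [exact Hc|].
      rewrite <- seq_shift, map_map; rewrite Forall2_map_l in IH |- *.
      revert IH; apply Forall2_impl; intros i e.
      replace (S i * m)%nat with (i * m + m)%nat by lia.
      now rewrite iter_add, Hxy.
Qed.

(** * Extension of self-maps of I to the real line *)

Definition clamp (x : R) : R := Rmax 0 (Rmin 1 x).

Lemma clamp_I x : I (clamp x).
Proof.
  unfold I, clamp, Rmax, Rmin; destruct (Rle_dec 1 x); destruct Rle_dec; lra.
Qed.

Lemma clamp_id x : I x -> clamp x = x.
Proof.
  unfold I, clamp, Rmax, Rmin; intros; destruct (Rle_dec 1 x); destruct Rle_dec; lra.
Qed.

Lemma clamp_lipschitz x y : Rabs (clamp x - clamp y) <= Rabs (x - y).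
Proof.
  unfold clamp, Rmax, Rmin, Rabs; repeat destruct Rle_dec; repeat destruct Rcase_abs; lra.
Qed.

(** Precomposing with the retraction onto I gives a map continuous on the whole line, to which
    real-variable theorems apply without side conditions. *)
Definition extend (f : R -> R) (x : R) : R := f (clamp x).

Lemma extend_continuity f : in_CII f -> continuity (extend f).
Proof.
  intros [_ Hc] x eps Heps.
  destruct (Hc (clamp x) (clamp_I x) eps Heps) as (d & Hd & H).
  exists d; split; [exact Hd|]; intros y [_ Hy].
  apply H; [apply clamp_I|].
  eapply Rle_lt_trans; [apply clamp_lipschitz | exact Hy].
Qed.

Lemma iter_I f t x : in_CII f -> I x -> I (iter f t x).
Proof.
  intros [Hf _] Hx; unfold iter; induction t; simpl; auto.
Qed.

Lemma iter_extend f t x : in_CII f -> I x -> iter (extend f) t x = iter f t x.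
Proof.
  intros Hf Hx; induction t as [|t IH]; [reflexivity|].
  change (extend f (iter (extend f) t x) = f (iter f t x)).
  unfold extend at 1; rewrite IH, clamp_id; [reflexivity | now apply iter_I].
Qed.

(** At time 0 the orbit of [x] is still unclamped, hence [1 <= t]. *)
Lemma iter_extend_clamp f t x : in_CII f -> (1 <= t)%nat ->
  iter (extend f) t x = iter f t (clamp x).
Proof.
  intros Hf Ht; rewrite <- (iter_extend f t (clamp x) Hf (clamp_I x)).
  destruct t as [|t]; [lia|].
  rewrite <- Nat.add_1_r, !iter_add; f_equal; simpl.
  unfold iter, extend; simpl; now rewrite (clamp_id (clamp x) (clamp_I x)).
Qed.

(** * Minimal subcovers and increasing lists of times *)

Lemma least_nat (P : nat -> Prop) n :
  P n -> exists m, P m /\ forall m', P m' -> (m <= m')%nat.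
Proof.
  induction n as [n IH] using (well_founded_induction lt_wf); intros Hn.
  destruct (classic (exists m, (m < n)%nat /\ P m)) as [(m & Hm & Pm)|H].
  - exact (IH m Hm Pm).
  - exists n; split; [exact Hn|]; intros m' Pm'.
    destruct (le_lt_dec n m'); [assumption | exfalso; eauto].
Qed.

Lemma greatest_nat (P : nat -> Prop) b n :
  P n -> (forall m, P m -> (m <= b)%nat) ->
  exists m, P m /\ forall m', P m' -> (m' <= m)%nat.
Proof.
  intros Hn Hb.
  destruct (least_nat (fun d => exists m, P m /\ m + d = b)%nat (b - n)) as (d & (m & Pm & E) & H).
  - exists n; split; [exact Hn|]; specialize (Hb n Hn); lia.
  - exists m; split; [exact Pm|]; intros m' Pm'; specialize (Hb m' Pm').
    assert (d <= b - m')%nat by (apply H; exists m'; split; [exact Pm' | lia]); lia.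
Qed.

Lemma Ncov_spec {J} (P : J -> Prop) V m : has_subcover_le P V m ->
  has_subcover_le P V (Ncov P V) /\ (Ncov P V <= m)%nat.
Proof.
  intros H.
  assert (has_subcover_le P V (Ncov P V) /\
    forall m', has_subcover_le P V m' -> (Ncov P V <= m')%nat) as [H1 H2].
  { apply (epsilon_spec (inhabits 0%nat) (fun m => has_subcover_le P V m /\
       forall m', has_subcover_le P V m' -> (m <= m')%nat)).
    exact (least_nat _ _ H). }
  auto.
Qed.

(** A free choice of cover member at each time gives k^n names. This crude bound makes the minimum
    in [Ncov] and the maximum in [pstar] exist. *)
Lemma join_subcover f k U t n : in_CII f -> open_cover k U ->
  has_subcover_le (join_idx k n) (join_set f U t n) (k ^ n)%nat.
Proof.
  intros Hf [_ HU]; induction n as [|n (S & [HS1 HS2] & HS3)].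
  - exists ((fun _ => 0%nat) :: nil); split; [split|simpl; lia].
    + intros g _ i Hi; lia.
    + intros x Hx; eexists; split; [left; reflexivity|].
      split; [exact Hx | intros i Hi; lia].
  - exists (map (fun gj : (nat -> nat) * nat =>
             fun i => if Nat.eq_dec i n then snd gj else fst gj i) (list_prod S (seq 0 k))).
    split; [split|].
    + intros g Hg i Hi; apply in_map_iff in Hg as ((h & j) & <- & Hh).
      apply in_prod_iff in Hh as [Hh Hj]; apply in_seq in Hj; simpl.
      destruct Nat.eq_dec; [lia|]; apply (HS1 h Hh); lia.
    + intros x Hx; destruct (HS2 x Hx) as (h & Hh & _ & H).
      destruct (HU (iter f (t n) x) (iter_I f _ x Hf Hx)) as (j & Hj & Hj').
      eexists; split.
      * apply in_map, in_prod; [exact Hh|]; apply in_seq; split; [lia | exact Hj].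
      * split; [exact Hx|]; intros i Hi; simpl.
        destruct Nat.eq_dec; [now subst | apply H; lia].
    + rewrite length_map, length_prod, length_seq; simpl; nia.
Qed.

Lemma strongly_sorted_app (l1 l2 : list nat) :
  StronglySorted lt l1 -> StronglySorted lt l2 ->
  (forall a b, In a l1 -> In b l2 -> (a < b)%nat) -> StronglySorted lt (l1 ++ l2).
Proof.
  intros H1 H2 H; induction l1 as [|a l1 IH]; simpl; [exact H2|].
  apply StronglySorted_inv in H1 as [H1 Ha].
  constructor; [apply IH; simpl in *; auto|].
  rewrite Forall_forall in *; intros b Hb; apply in_app_iff in Hb as [Hb|Hb]; simpl in *; auto.
Qed.

Lemma strongly_sorted_skipn (k : nat) : forall j l,
  StronglySorted lt l -> Forall (le j) l ->
  StronglySorted lt (skipn k l) /\ Forall (le (j + k)) (skipn k l).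
Proof.
  induction k as [|k IH]; intros j l Hl Hj; simpl.
  - rewrite Nat.add_0_r; auto.
  - destruct l as [|a l]; [auto|].
    apply StronglySorted_inv in Hl as [Hl Ha].
    replace (j + S k)%nat with (S j + k)%nat by lia; apply IH; [exact Hl|].
    inversion Hj; subst; rewrite Forall_forall in *; intros b Hb; specialize (Ha b Hb); lia.
Qed.

Lemma strongly_sorted_nth l i : StronglySorted lt l -> (S i < length l)%nat ->
  (nth i l 0 < nth (S i) l 0)%nat.
Proof.
  revert i; induction l as [|a l IH]; intros i Hl Hi; simpl in *; [lia|].
  apply StronglySorted_inv in Hl as [Hl Ha]; destruct i as [|i].
  - rewrite Forall_forall in Ha; apply Ha, nth_In; lia.
  - apply IH; [exact Hl | lia].
Qed.

Lemma indep_skipn F u v k ss : indep F u v ss -> indep F u v (skipn k ss).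
Proof.
  intros H w Hw.
  (* The word is padded with [false] on the dropped times. *)
  destruct (H (repeat false (length (firstn k ss)) ++ w)) as (x & Hx).
  - rewrite length_app, repeat_length, Hw, <- length_app, firstn_skipn; reflexivity.
  - exists x; rewrite <- (firstn_skipn k ss) in Hx at 1.
    apply Forall2_app_inv_l in Hx as (w1 & w2 & H1 & H2 & E).
    apply Forall2_length in H1.
    assert (w = w2) as -> ; [|exact H2].
    apply (f_equal (skipn (length (firstn k ss)))) in E.
    rewrite !skipn_app in E.
    rewrite <- H1, Nat.sub_diag, repeat_length, Nat.sub_diag in E.
    rewrite skipn_all2, (skipn_all2 w1) in E by (rewrite ?repeat_length; lia); exact E.
Qed.

(** * Null maps have bounded independence *)

(** A point [<= u] lies only in member 0, a point [>= v] only in member 1, so an independence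
    pattern forces the indices. *)
Definition level_cover (u v : R) (j : nat) (y : R) : Prop :=
  match j with O => y < v | S _ => u < y end.

Lemma level_cover_open u v : u < v -> open_cover 2 (level_cover u v).
Proof.
  intros Huv; split.
  - intros [|j] _ x _ Hx; simpl in *.
    + exists (v - x); split; [lra|]; intros y _ Hy; apply Rabs_def2 in Hy; lra.
    + exists (x - u); split; [lra|]; intros y _ Hy; apply Rabs_def2 in Hy; lra.
  - intros x _; destruct (Rlt_dec x v).
    + exists 0%nat; split; [lia | assumption].
    + exists 1%nat; split; [lia | simpl; lra].
Qed.

(* A point realising a pattern on the times [t m, ..., t (m+b-1)] lies in a member of the join only if that member's indices spell the pattern. *)
Lemma Njoin_indep_lower f u v t m b : in_CII f -> u < v ->
  (forall i, (i < b)%nat -> (1 <= t (m + i))%nat) ->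
  indep (extend f) u v (map (fun i => t (m + i)%nat) (seq 0 b)) ->
  (2 ^ b <= Njoin f 2 (level_cover u v) t (m + b))%nat.
Proof.
  intros Hf Huv Ht Hi.
  destruct (Ncov_spec _ _ _ (join_subcover f 2 _ t (m + b) Hf (level_cover_open u v Huv)))
    as [(S & [HS1 HS2] & HS3) _].
  fold (Njoin f 2 (level_cover u v) t (m + b)) in HS3.
  eapply Nat.le_trans; [|exact HS3].
  rewrite <- words_length.
  (* Reading the indices at the last [b] times sends the subcover onto all words of length [b]. *)
  rewrite <- (length_map (fun g : nat -> nat =>
    map (fun i => negb (Nat.eqb (g (m + i)%nat) 0)) (seq 0 b)) S).
  apply NoDup_incl_length; [apply words_NoDup|].
  intros w Hw; apply in_words in Hw.
  destruct (Hi w) as (x & Hx); [now rewrite length_map, length_seq|].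
  (* [S] covers only I; [clamp x] lies there and has the same orbit as [x] from time 1 on. *)
  destruct (HS2 (clamp x) (clamp_I x)) as (g & Hg & _ & Hgx).
  apply in_map_iff; exists g; split; [|exact Hg].
  apply Forall2_map_l, (Forall2_nth_iff _ 0%nat false) in Hx as [_ Hx].
  rewrite length_seq in Hx.
  apply (nth_ext _ _ false false); rewrite length_map, length_seq; [auto|].
  intros i Hib.
  rewrite (nth_indep _ false (negb (Nat.eqb (g (m + 0)%nat) 0))) by (now rewrite length_map, length_seq).
  rewrite (map_nth (fun i => negb (Nat.eqb (g (m + i)%nat) 0))), seq_nth by exact Hib.
  specialize (Hx i Hib); rewrite seq_nth in Hx by exact Hib; simpl in *.
  specialize (Hgx (m + i)%nat ltac:(lia)).
  rewrite <- iter_extend_clamp in Hgx by auto.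
  destruct (g (m + i)%nat), (nth i w false); simpl in *; try reflexivity; lra.
Qed.

Lemma ln_ratio_lower N n b : (0 < n)%nat -> (n <= 2 * b)%nat -> (2 ^ b <= N)%nat ->
  ln 2 / 2 <= ln (INR N) / INR n.
Proof.
  intros Hn Hb HN.
  assert (H2 : 0 < ln 2) by (rewrite <- ln_1; apply ln_increasing; lra).
  assert (INR b * ln 2 <= ln (INR N)).
  { rewrite <- ln_pow by lra.
    change 2 with (INR 2); rewrite <- pow_INR.
    apply le_INR in HN; destruct HN as [HN|HN].
    - left; apply ln_increasing; [|exact HN].
      apply lt_0_INR, Nat.neq_0_lt_0, Nat.pow_nonzero; lia.
    - rewrite HN; lra. }
  apply le_INR in Hb; rewrite mult_INR in Hb; simpl in Hb.
  assert (0 < INR n) by (now apply lt_0_INR).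
  apply (Rmult_le_reg_r (INR n)); [assumption|].
  unfold Rdiv at 2; rewrite Rmult_assoc, Rinv_l, Rmult_1_r by lra.
  nra.
Qed.

Section Blocks.

Variable block : list nat -> list nat.
Hypothesis block_sorted : forall l, StronglySorted lt (block l).
Hypothesis block_above : forall l s, In s (block l) -> (list_max l < s)%nat.
Hypothesis block_nonempty : forall l, (1 <= length (block l))%nat.

(** [block] sees all earlier times, so a new block can start beyond them and outnumber them. *)
Fixpoint blocks (k : nat) : list nat :=
  match k with O => nil | S k => blocks k ++ block (blocks k) end.

(** Stage [S i] has more than [i] entries and later stages only append, so the default is never
    read. *)
Definition blocks_seq (i : nat) : nat := nth i (blocks (S i)) 0%nat.

Lemma blocks_length k : (k <= length (blocks k))%nat.
Proof.
  induction k as [|k IH]; simpl; [lia|].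
  rewrite length_app; specialize (block_nonempty (blocks k)); lia.
Qed.

Lemma blocks_sorted k : StronglySorted lt (blocks k).
Proof.
  induction k as [|k IH]; simpl; [constructor|].
  apply strongly_sorted_app; auto.
  intros a b Ha Hb; apply block_above in Hb.
  assert (Hm := proj1 (list_max_le (blocks k) _) (le_n _)).
  rewrite Forall_forall in Hm; specialize (Hm a Ha); lia.
Qed.

Lemma blocks_nth k d i : (i < length (blocks k))%nat ->
  nth i (blocks (d + k)) 0%nat = nth i (blocks k) 0%nat.
Proof.
  intros Hi; induction d as [|d IH]; [reflexivity|].
  simpl; rewrite app_nth1; [exact IH|].
  clear IH; induction d as [|d IH]; simpl; [exact Hi|]; rewrite length_app; lia.
Qed.

Lemma blocks_seq_nth k i : (i < length (blocks k))%nat ->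
  blocks_seq i = nth i (blocks k) 0%nat.
Proof.
  intros Hi; unfold blocks_seq.
  assert (Hl := blocks_length (S i)).
  destruct (le_lt_dec k (S i)).
  - replace (S i) with ((S i - k) + k)%nat by lia; now apply blocks_nth.
  - replace k with ((k - S i) + S i)%nat by lia; symmetry; now apply blocks_nth.
Qed.

Lemma blocks_seq_incr : strictly_incr blocks_seq.
Proof.
  intros i; assert (Hl := blocks_length (S (S i))).
  rewrite (blocks_seq_nth (S (S i)) i), (blocks_seq_nth (S (S i)) (S i)) by lia.
  apply strongly_sorted_nth; [apply blocks_sorted | lia].
Qed.

Lemma blocks_seq_block k :
  map (fun i => blocks_seq (length (blocks k) + i)%nat) (seq 0 (length (block (blocks k))))
  = block (blocks k).
Proof.
  apply (nth_ext _ _ 0%nat 0%nat); rewrite length_map, length_seq; [reflexivity|].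
  intros i Hi.
  rewrite (nth_indep _ 0%nat (blocks_seq (length (blocks k) + 0)%nat))
    by (now rewrite length_map, length_seq).
  rewrite (map_nth (fun i => blocks_seq (length (blocks k) + i)%nat)), seq_nth by exact Hi.
  rewrite (blocks_seq_nth (S k)) by (simpl; rewrite length_app; lia).
  simpl; rewrite app_nth2 by lia; f_equal; lia.
Qed.

End Blocks.

(* Arbitrarily large independence sets, each dominating in size everything before it, are concatenated into one sequence [A] with [h_A >= (ln 2) / 2]. *)
Lemma null_bounded_indep f : in_CII f -> null f -> bounded_indep (extend f).
Proof.
  intros Hf Hnull u v Huv; apply NNPP; intros HD.
  assert (Hbl : forall l : list nat, exists bl, StronglySorted lt bl /\
    (forall s, In s bl -> (list_max l < s)%nat) /\ (length l < length bl)%nat /\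
    indep (extend f) u v bl).
  { intros l; apply NNPP; intros Hl; apply HD.
    (* Dropping the first [S (list_max l)] times leaves only times above [list_max l], and
       [S (length l)] of them remain. *)
    exists (S (list_max l) + S (length l))%nat; intros ss Hs Hlen Hi; apply Hl.
    destruct (strongly_sorted_skipn (S (list_max l)) 0 ss Hs) as [H1 H2].
    { apply Forall_forall; intros; lia. }
    exists (skipn (S (list_max l)) ss); repeat split.
    - exact H1.
    - rewrite Forall_forall in H2; exact H2.
    - rewrite length_skipn; lia.
    - now apply indep_skipn. }
  apply choice in Hbl as (block & Hblock).
  assert (H1 : forall l, StronglySorted lt (block l)) by apply Hblock.
  assert (H2 : forall l s, In s (block l) -> (list_max l < s)%nat) by apply Hblock.
  assert (H3 : forall l, (1 <= length (block l))%nat).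
  { intros l; destruct (Hblock l) as (_ & _ & H & _); lia. }
  destruct (Hnull (blocks_seq block) 2%nat _ (blocks_seq_incr block H1 H2 H3)
              (level_cover_open u v Huv)) as [Hup _].
  assert (Hln : 0 < ln 2) by (rewrite <- ln_1; apply ln_increasing; lra).
  (* The last block fills more than half of the first [m + b] times, so the ratio there is at least
     (ln 2)/2, against a limsup of 0. *)
  destruct (Hup (ln 2 / 2)) as (N & HN); [lra|].
  set (m := length (blocks block N)).
  set (b := length (block (blocks block N))).
  assert (HmN : (N <= m)%nat) by (apply blocks_length; exact H3).
  destruct (Hblock (blocks block N)) as (_ & _ & Hmb & Hind); fold m b in Hmb.
  specialize (HN (m + b)%nat ltac:(lia)).
  apply (Rlt_not_le _ _ HN); rewrite Rplus_0_l.
  apply (ln_ratio_lower _ _ b); [lia | lia|].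
  assert (E := blocks_seq_block block H3 N); fold m b in E.
  apply Njoin_indep_lower; [exact Hf | exact Huv | |].
  - intros i Hi.
    assert (In (blocks_seq block (m + i)) (block (blocks block N))) as H.
    { rewrite <- E; apply (in_map (fun i => blocks_seq block (m + i)%nat)), in_seq; lia. }
    apply H2 in H; lia.
  - rewrite E; exact Hind.
Qed.

(** * Gaps with finitely many futures *)

Lemma minus_id_continuity g : continuity g -> continuity (fun x => g x - x).
Proof.
  intros Hg; apply (continuity_minus g (fun x => x)); [exact Hg|].
  exact (derivable_continuous _ derivable_id).
Qed.

Lemma fixed_point_free_same_side g p q x y : continuity g ->
  (forall z, p < z < q -> g z <> z) -> p < x < q -> p < y < q ->
  x < g x -> y < g y.
Proof.
  intros Hg Hfix Hx Hy Hxg.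
  destruct (Rlt_le_dec y (g y)) as [|Hyg]; [assumption|exfalso].
  destruct (Rle_dec x y).
  - destruct (intermediate_value _ x y 0 (minus_id_continuity g Hg)) as (z & Hz & E); [lra|lra|].
    apply (Hfix z); lra.
  - destruct (intermediate_value _ y x 0 (minus_id_continuity g Hg)) as (z & Hz & E); [lra|lra|].
    apply (Hfix z); lra.
Qed.

Definition periodic_free (F : R -> R) (p q : R) : Prop :=
  forall n x, (1 <= n)%nat -> p < x < q -> iter F n x <> x.

Lemma periodic_free_opp F p q : periodic_free F p q ->
  periodic_free (fun y => - F (- y)) (- q) (- p).
Proof.
  intros H n x Hn Hx E; rewrite iter_opp in E.
  apply (H n (- x)); [assumption | lra | lra].
Qed.

(** Without periodic points the sign of F^(ns)(x) - x is constant on [(p,q)], so [z] suffices as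
    test point: it moves right to F^s(z), which by induction moves further right. *)
Lemma return_multiples F p q s z : continuity F -> periodic_free F p q ->
  (1 <= s)%nat -> p < z < q -> p < iter F s z < q -> z < iter F s z ->
  forall n x, (1 <= n)%nat -> p < x < q -> x < iter F (n * s) x.
Proof.
  intros HF Hper Hs Hz Hsz Hup n x Hn Hx.
  revert x Hx; induction Hn as [|n Hn IH]; intros x Hx.
  - rewrite Nat.mul_1_l.
    apply (fixed_point_free_same_side _ p q z); auto using iter_continuity.
  - apply (fixed_point_free_same_side _ p q z); auto using iter_continuity.
    + intros y Hy; apply Hper; [nia | exact Hy].
    + replace (S n * s)%nat with (n * s + s)%nat by lia.
      rewrite iter_add; specialize (IH _ Hsz); lra.
Qed.

(** Otherwise F^(rs) would move [z] right, as the [s]-th multiple of the return time [r], and left,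
    as the [r]-th multiple of [s]. *)
Lemma returns_same_direction F p q r s y z : continuity F -> periodic_free F p q ->
  (1 <= r)%nat -> p < y < q -> p < iter F r y < q -> y < iter F r y ->
  (1 <= s)%nat -> p < z < q -> p < iter F s z < q -> z < iter F s z.
Proof.
  intros HF Hper Hr Hy Hry Hup Hs Hz Hsz.
  destruct (Rlt_le_dec z (iter F s z)) as [|Hle]; [assumption | exfalso].
  assert (iter F s z <> z) by (apply Hper; assumption).
  assert (H1 := return_multiples F p q r y HF Hper Hr Hy Hry Hup s z Hs Hz).
  assert (H2 := return_multiples _ (- q) (- p) s (- z) (opp_conj_continuity F HF)
                  (periodic_free_opp F p q Hper) Hs).
  rewrite iter_opp, Ropp_involutive in H2.
  specialize (H2 ltac:(lra) ltac:(lra) ltac:(lra) r (- z) Hr ltac:(lra)).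
  rewrite iter_opp, Ropp_involutive, Nat.mul_comm in H2; lra.
Qed.

(** Forces any return to a small neighbourhood of [z] to take more than [n] steps. *)
Lemma early_returns_avoided F z n : continuity F ->
  (forall r, (1 <= r <= n)%nat -> iter F r z <> z) ->
  exists d, 0 < d /\ forall x r, Rabs (x - z) < d -> (1 <= r <= n)%nat ->
    d <= Rabs (iter F r x - z).
Proof.
  intros HF; induction n as [|n IH]; intros Hz.
  - exists 1; split; [lra|]; intros; lia.
  - destruct IH as (d1 & Hd1 & H1); [intros; apply Hz; lia|].
    assert (He : 0 < Rabs (iter F (S n) z - z)).
    { apply Rabs_pos_lt; specialize (Hz (S n) ltac:(lia)); lra. }
    set (e := Rabs (iter F (S n) z - z)) in *.
    destruct (continuity_eps _ z (e / 2) (iter_continuity F (S n) HF)) as (d2 & Hd2 & H2); [lra|].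
    exists (Rmin d1 (Rmin d2 (e / 2))); split.
    { apply Rmin_glb_lt; [|apply Rmin_glb_lt]; lra. }
    assert (B1 := Rmin_l d1 (Rmin d2 (e / 2))); assert (B2 := Rmin_r d1 (Rmin d2 (e / 2))).
    assert (B3 := Rmin_l d2 (e / 2)); assert (B4 := Rmin_r d2 (e / 2)).
    intros x r Hx Hr; destruct (Nat.eq_dec r (S n)) as [->|].
    + specialize (H2 x ltac:(lra)).
      assert (T := Rabs_triang (iter F (S n) x - z) (- (iter F (S n) x - iter F (S n) z))).
      replace (iter F (S n) x - z + - (iter F (S n) x - iter F (S n) z))
        with (iter F (S n) z - z) in T by ring.
      rewrite Rabs_Ropp in T; fold e in T; lra.
    + specialize (H1 x r ltac:(lra) ltac:(lia)); lra.
Qed.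

Definition wandering (F : R -> R) (u v : R) : Prop :=
  forall s x, (1 <= s)%nat -> u < x < v -> ~ (u < iter F s x < v).

(** If every subinterval had a return, some [z] would return to [y] at time [s]. A point [z1] very
    near [z] returns near [z] only at a time [r > s], passing near [y] at time [s]; from there it
    goes back towards [z], a return in the opposite direction. *)
Lemma periodic_free_wandering F p q : continuity F -> p < q -> periodic_free F p q ->
  exists u v, p < u /\ u < v /\ v < q /\ wandering F u v.
Proof.
  intros HF Hpq Hper; apply NNPP; intros Hno.
  assert (Hret : forall u v, p < u -> u < v -> v < q -> exists s x,
    (1 <= s)%nat /\ u < x < v /\ u < iter F s x < v).
  { intros u v Hu Huv Hv; apply NNPP; intros H; apply Hno.
    exists u, v; repeat split; auto; intros s x Hs Hx Hsx; apply H; eauto. }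
  destruct (Hret ((2 * p + q) / 3) ((p + 2 * q) / 3)) as (s & z & Hs & Hz & Hsz); [lra..|].
  assert (Hzp : p < z < q) by lra; assert (Hszp : p < iter F s z < q) by lra.
  set (y := iter F s z) in *.
  assert (Hyz : y <> z) by (apply Hper; assumption).
  destruct (early_returns_avoided F z s HF) as (d1 & Hd1 & H1).
  { intros r Hr; apply Hper; [lia | exact Hzp]. }
  (* Within [e] of [y] a point stays in [(p,q)] and at least [e] away from [z]. *)
  set (e := Rmin (Rabs (y - z) / 2) (Rmin (y - p) (q - y))).
  assert (0 < Rabs (y - z)) by (apply Rabs_pos_lt; lra).
  assert (He : 0 < e) by (repeat apply Rmin_glb_lt; lra).
  assert (E1 : e <= Rabs (y - z) / 2) by apply Rmin_l.
  assert (E2 : e <= Rmin (y - p) (q - y)) by apply Rmin_r.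
  assert (E3 := Rmin_l (y - p) (q - y)); assert (E4 := Rmin_r (y - p) (q - y)).
  destruct (continuity_eps _ z e (iter_continuity F s HF) He) as (d2 & Hd2 & H2).
  fold y in H2.
  (* [d1] rules out returns up to time [s], [d2] puts F^s(z1) within [e] of [y], and the last term
     keeps the neighbourhood of [z] inside [(p,q)] and clear of that of [y]. *)
  set (d := Rmin (Rmin d1 d2) (Rmin e (Rmin (z - p) (q - z)) / 2)).
  assert (Hm : 0 < Rmin e (Rmin (z - p) (q - z))) by (repeat apply Rmin_glb_lt; lra).
  assert (Hd : 0 < d) by (repeat apply Rmin_glb_lt; lra).
  assert (D1 : d <= Rmin d1 d2) by apply Rmin_l.
  assert (D2 : d <= Rmin e (Rmin (z - p) (q - z)) / 2) by apply Rmin_r.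
  assert (D3 := Rmin_l d1 d2); assert (D4 := Rmin_r d1 d2).
  assert (D5 := Rmin_l e (Rmin (z - p) (q - z))); assert (D6 := Rmin_r e (Rmin (z - p) (q - z))).
  assert (D7 := Rmin_l (z - p) (q - z)); assert (D8 := Rmin_r (z - p) (q - z)).
  destruct (Hret (z - d) (z + d)) as (r & z1 & Hr & Hz1 & Hrz1); [lra..|].
  assert (A1 : Rabs (z1 - z) < d) by (apply Rabs_def1; lra).
  assert (A2 : Rabs (iter F r z1 - z) < d) by (apply Rabs_def1; lra).
  assert (Hsr : (s < r)%nat).
  { apply Nat.nle_gt; intros Hle; specialize (H1 z1 r ltac:(lra) ltac:(lia)); lra. }
  specialize (H2 z1 ltac:(lra)); apply Rabs_def2 in H2.
  set (z2 := iter F s z1) in *.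
  assert (E : iter F (r - s) z2 = iter F r z1).
  { unfold z2; rewrite <- iter_add; f_equal; lia. }
  assert (Hz2 : p < z2 < q) by lra.
  assert (Hrz2 : p < iter F (r - s) z2 < q) by lra.
  assert (K1 := returns_same_direction F p q s (r - s) z z2 HF Hper Hs Hzp Hszp).
  assert (K2 := returns_same_direction F p q (r - s) s z2 z HF Hper ltac:(lia) Hz2 Hrz2).
  fold y in K1, K2.
  destruct (Rlt_le_dec z y).
  - rewrite Rabs_right in E1 by lra.
    specialize (K1 ltac:(lra) ltac:(lia) Hz2 Hrz2); lra.
  - rewrite Rabs_left1 in E1 by lra.
    specialize (K2 ltac:(lra) Hs Hzp Hszp); lra.
Qed.

(** * Dense periodic points without horseshoes *)

Definition periodic_dense (F : R -> R) (p q : R) : Prop :=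
  forall u v, p < u -> u < v -> v < q ->
    exists n x, (1 <= n)%nat /\ u < x < v /\ iter F n x = x.

Lemma periodic_dense_opp F p q : periodic_dense F p q ->
  periodic_dense (fun y => - F (- y)) (- q) (- p).
Proof.
  intros H u v Hu Huv Hv; destruct (H (- v) (- u)) as (n & x & Hn & Hx & E); [lra..|].
  exists n, (- x); rewrite iter_opp, Ropp_involutive, E; repeat split; auto; lra.
Qed.

Lemma iter_periodic F k n x : iter F n x = x -> iter F (k * n) x = x.
Proof.
  intros H; rewrite <- iter_iter; now apply iter_fixed.
Qed.

(** An orbit staying in [(a,b)] would increase forever, so a periodic one leaves. Its first exit
    point lies beyond [b], since the fixed point [b] never leads back to [w]. *)
Lemma periodic_exit g a b M n w : a < b -> g b = b ->
  (forall x, a < x < b -> x < g x) -> (forall x, a <= x <= b -> g x <= M) ->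
  (1 <= n)%nat -> a < w < b -> iter g n w = w ->
  exists y l, b < y /\ y <= M /\ iter g l y = w.
Proof.
  intros Hab Hb Hup HM Hn Hw Hper.
  destruct (classic (forall i, a < iter g i w < b)) as [Hin|Hout].
  - exfalso; assert (Hinc : forall i, w < iter g (S i) w).
    { induction i as [|i IH]; [apply Hup; exact Hw|].
      assert (H := Hup _ (Hin (S i))).
      change (w < g (iter g (S i) w)); lra. }
    specialize (Hinc (n - 1)%nat).
    replace (S (n - 1)) with n in Hinc by lia; lra.
  - apply not_all_ex_not in Hout as (i0 & Hi0).
    destruct (least_nat (fun i => ~ (a < iter g i w < b)) i0 Hi0) as ([|i] & Hi & Hmin).
    { exfalso; apply Hi; exact Hw. }
    assert (Hj : a < iter g i w < b).
    { apply NNPP; intros H; apply Hmin in H; lia. }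
    assert (Hj' := Hup _ Hj); assert (HjM := HM (iter g i w) ltac:(lra)).
    change (iter g (S i) w) with (g (iter g i w)) in Hi.
    (* [n * S i] is a multiple of the period and at least [S i]; the difference leads from the exit
       point back to [w]. *)
    assert (Hl : iter g (n * S i - S i) (g (iter g i w)) = w).
    { change (iter g (n * S i - S i) (iter g (S i) w) = w).
      rewrite <- iter_add, Nat.sub_add by nia.
      rewrite Nat.mul_comm; now apply iter_periodic. }
    exists (g (iter g i w)), (n * S i - S i)%nat; split; [|auto].
    destruct (Req_dec (g (iter g i w)) b) as [E|]; [|lra].
    rewrite E, iter_fixed in Hl by exact Hb; lra.
Qed.

(* Periodic points near [a] must leave [(a,b)] through its right end and come back; together with a point where [g] is maximal on [[a,b]] this makes a horseshoe. *)
Lemma periodic_dense_no_ascent F N a b : continuity F -> bounded_indep F ->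
  periodic_dense F a b -> (1 <= N)%nat -> a < b -> iter F N a = a -> iter F N b = b ->
  (forall x, a < x < b -> x < iter F N x) -> False.
Proof.
  intros HF HB Hd HN Hab Ha Hb Hup.
  assert (Hg := iter_continuity F N HF).
  destruct (continuity_ab_maj (iter F N) a b) as (x1 & HM & Hx1); [lra | auto |].
  assert (Hexit : forall n w, (1 <= n)%nat -> a < w < b -> iter F n w = w ->
    exists y l, b < y /\ y <= iter F N x1 /\ iter (iter F N) l y = w).
  { intros n w Hn Hw Hper; apply (periodic_exit _ a b _ n); auto.
    rewrite iter_iter, Nat.mul_comm; now apply iter_periodic. }
  set (g := iter F N) in *.
  assert (HMb : b < g x1).
  { destruct (Hd ((2 * a + b) / 3) ((a + 2 * b) / 3)) as (n & w & Hn & Hw & Hper); [lra..|].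
    destruct (Hexit n w Hn ltac:(lra) Hper) as (y & l & Hy & HyM & _); lra. }
  assert (Hax1 : a < x1) by (destruct (Req_dec a x1) as [<-|]; lra).
  assert (Hx1b : x1 < b) by (destruct (Req_dec x1 b) as [->|]; lra).
  destruct (continuity_eps g a (b - a) Hg) as (d & Hd0 & Hda); [lra|].
  (* [w] is so close to the fixed point [a] that [g w < b], and it lies left of the maximum point
     [x1]. *)
  set (w := a + Rmin d (x1 - a) / 2).
  assert (0 < Rmin d (x1 - a)) by (apply Rmin_glb_lt; lra).
  assert (M1 := Rmin_l d (x1 - a)); assert (M2 := Rmin_r d (x1 - a)).
  assert (Hw : a < w < x1) by (unfold w; lra).
  assert (Hgw : g w < b).
  { specialize (Hda w); rewrite Ha in Hda.
    assert (Hwa : Rabs (w - a) < d) by (apply Rabs_def1; unfold w; lra).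
    apply Hda, Rabs_def2 in Hwa; lra. }
  (* The periodic point [w0 < w] is reached from some [y0 > b] in [l] steps while [b] is fixed, so
     some [y] between [b] and [y0] reaches [w] itself. *)
  destruct (Hd ((a + w) / 2) w) as (n & w0 & Hn & Hw0 & Hper); [lra..|].
  destruct (Hexit n w0 Hn ltac:(lra) Hper) as (y0 & l & Hy0 & Hy0M & Hl).
  assert (Hgl := iter_continuity g l Hg).
  assert (Hlb : iter g l b = b) by (apply iter_fixed; exact Hb).
  destruct (intermediate_value _ b y0 w Hgl) as (y & Hy & Hyw); [lra | lra |].
  assert (b <> y) by (intros <-; lra).
  assert (y <> y0) by (intros ->; lra).
  (* [g] goes from below [b] at [w] to above [y] at [x1] and back to [b]: both [[w,alpha]] and
     [[beta,b]] are mapped over [[b,y]], which [l] further steps map over [[w,b]]. *)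
  destruct (intermediate_value g w x1 y Hg) as (alpha & Halpha & Egalpha); [lra | lra |].
  destruct (intermediate_value g x1 b y Hg) as (beta & Hbeta & Egbeta); [lra | lra |].
  assert (alpha <> x1) by (intros ->; lra).
  assert (Hcov : forall t, w <= t <= b -> exists s, b <= s <= y /\ iter g l s = t).
  { intros t Ht; apply intermediate_value; [exact Hgl | lra | lra]. }
  apply (no_horseshoe F (l * N + N) w alpha beta b); [exact HB | lia | lra | lra | lra | |].
  - intros t Ht; destruct (Hcov t Ht) as (s & Hs & Est).
    destruct (intermediate_value g w alpha s Hg) as (x & Hx & Exs); [lra | lra |].
    exists x; split; [exact Hx|].
    rewrite iter_add, <- iter_iter; fold g; now rewrite Exs.
  - intros t Ht; destruct (Hcov t Ht) as (s & Hs & Est).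
    destruct (intermediate_value g beta b s Hg) as (x & Hx & Exs); [lra | lra |].
    exists x; split; [exact Hx|].
    rewrite iter_add, <- iter_iter; fold g; now rewrite Exs.
Qed.

(** The supremum of the fixed points in [[p,x0]] is itself fixed, by continuity. *)
Lemma last_fixed_point g p x0 : continuity g -> p <= x0 -> g p = p -> g x0 <> x0 ->
  exists a, p <= a < x0 /\ g a = a /\ forall x, a < x <= x0 -> g x <> x.
Proof.
  intros Hg Hp Hgp Hx0.
  destruct (completeness (fun x => p <= x <= x0 /\ g x = x)) as (a & Hub & Hlub).
  - exists x0; intros x [Hx _]; lra.
  - exists p; split; [lra | exact Hgp].
  - assert (Hpa : p <= a) by (apply Hub; split; [lra | exact Hgp]).
    assert (Hax0 : a <= x0) by (apply Hlub; intros x [Hx _]; lra).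
    assert (Hga : g a = a).
    { apply NNPP; intros Hne.
      assert (He : 0 < Rabs (g a - a)) by (apply Rabs_pos_lt; lra).
      destruct (continuity_eps (fun x => g x - x) a _ (minus_id_continuity g Hg) He)
        as (d & Hd & H).
      assert (a <= a - d); [|lra].
      apply Hlub; intros x [Hx Egx].
      assert (x <= a) by (apply Hub; auto).
      apply Rnot_lt_le; intros Hxd.
      assert (Hxa : Rabs (x - a) < d) by (apply Rabs_def1; lra).
      apply H in Hxa; rewrite Egx in Hxa.
      replace (x - x - (g a - a)) with (- (g a - a)) in Hxa by ring.
      rewrite Rabs_Ropp in Hxa; lra. }
    exists a; repeat split; [exact Hpa | | exact Hga |].
    + destruct (Req_dec a x0) as [->|]; [contradiction | lra].
    + intros x Hx Egx; assert (x <= a) by (apply Hub; split; [lra | exact Egx]); lra.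
Qed.

(** A moved point [x0] lies between consecutive fixed points [a < b], and all of [(a,b)] moves in
    one direction. Ascent is excluded directly, descent after reflection. *)
Lemma periodic_dense_identity F N p q : continuity F -> bounded_indep F ->
  periodic_dense F p q -> (1 <= N)%nat -> iter F N p = p -> iter F N q = q ->
  forall x, p <= x <= q -> iter F N x = x.
Proof.
  intros HF HB Hd HN Hp Hq x0 Hx0; apply NNPP; intros Hne.
  assert (Hg := iter_continuity F N HF).
  destruct (last_fixed_point (iter F N) p x0) as (a & Ha & Hga & Hafix); [auto | lra | auto..|].
  (* The first fixed point right of [x0], obtained by reflection. *)
  destruct (last_fixed_point (fun y => - iter F N (- y)) (- q) (- x0)) as (b' & Hb & Hgb & Hbfix);
    rewrite ?Ropp_involutive; [now apply opp_conj_continuity | lra | lra | lra |].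
  set (b := - b') in *.
  assert (Hfree : forall z, a < z < b -> iter F N z <> z).
  { intros z Hz E; destruct (Rle_dec z x0).
    - apply (Hafix z); [lra | exact E].
    - apply (Hbfix (- z)); [unfold b in *; lra | rewrite Ropp_involutive, E; reflexivity]. }
  assert (Hx0' : a < x0 < b) by (unfold b; lra).
  assert (Hbq : b <= q) by (unfold b; lra).
  assert (Hgb' : iter F N b = b) by (unfold b in *; lra).
  assert (Hd' : periodic_dense F a b) by (intros u v Hu Huv Hv; apply Hd; lra).
  destruct (Rlt_le_dec x0 (iter F N x0)).
  - apply (periodic_dense_no_ascent F N a b); auto; [lra|].
    intros x Hx; apply (fixed_point_free_same_side _ a b x0); auto.
  - apply (periodic_dense_no_ascent (fun y => - F (- y)) N (- b) (- a));
      auto using opp_conj_continuity, bounded_indep_opp, periodic_dense_opp;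
      rewrite ?iter_opp, ?Ropp_involutive; [lra..|].
    intros x Hx; rewrite iter_opp.
    destruct (Rlt_le_dec x (- iter F N (- x))) as [|Hle]; [assumption | exfalso].
    assert (- x <> iter F N (- x)) by (apply not_eq_sym, Hfree; lra).
    assert (x0 < iter F N x0); [|lra].
    apply (fixed_point_free_same_side _ a b (- x)); auto; lra.
Qed.

(** The labels are weak: [true] only asserts [>= u] and [false] only [<= v], so either is correct
    inside the gap. *)
Definition finite_futures (F : R -> R) (u v : R) : Prop :=
  exists Rho : list (nat -> bool), forall y, u < y < v -> exists rho, In rho Rho /\
    forall s, if rho s then u <= iter F s y else iter F s y <= v.

(** Each later image of the gap is connected and misses the gap, so the itinerary of the midpoint is
    valid for every point. *)
Lemma wandering_finite_futures F u v : continuity F -> u < v -> wandering F u v ->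
  finite_futures F u v.
Proof.
  intros HF Huv Hw.
  set (mid := (u + v) / 2); assert (Hmid : u < mid < v) by (unfold mid; lra).
  exists ((fun s => if Rle_dec v (iter F s mid) then true else false) :: nil).
  intros y Hy; eexists; split; [left; reflexivity|].
  intros [|s]; [destruct Rle_dec; simpl; lra|].
  assert (Hws := fun x Hx => Hw (S s) x ltac:(lia) Hx).
  assert (Hg := iter_continuity F (S s) HF).
  assert (Hmiss : ~ (iter F (S s) mid <= mid <= iter F (S s) y \/
                   iter F (S s) y <= mid <= iter F (S s) mid)).
  { intros H; destruct (Rle_dec mid y).
    - destruct (intermediate_value _ mid y mid Hg) as (x & Hx & E); [lra | lra |].
      apply (Hws x); lra.
    - destruct (intermediate_value _ y mid mid Hg) as (x & Hx & E); [lra | lra |].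
      apply (Hws x); lra. }
  specialize (Hws mid Hmid); destruct Rle_dec; lra.
Qed.

(** Itineraries of points in the gap repeat with period [N], so the words of length [N] give all
    futures. *)
Lemma identity_finite_futures F N u v : (1 <= N)%nat -> u < v ->
  (forall x, u <= x <= v -> iter F N x = x) -> finite_futures F u v.
Proof.
  intros HN Huv Hid.
  exists (map (fun w s => nth (s mod N) w false) (words N)).
  intros y Hy.
  set (h := fun s => if Rle_dec u (iter F s y) then true else false).
  exists (fun s => nth (s mod N) (map h (seq 0 N)) false); split.
  - apply (in_map (fun w s => nth (s mod N) w false)), in_words.
    now rewrite length_map, length_seq.
  - intros s.
    assert (Hs : (s mod N < N)%nat) by (apply Nat.mod_upper_bound; lia).
    rewrite (nth_indep _ false (h 0%nat)) by (now rewrite length_map, length_seq).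
    rewrite map_nth, seq_nth by exact Hs.
    assert (E : iter F s y = iter F (s mod N) y).
    { rewrite (Nat.div_mod_eq s N) at 1.
      rewrite Nat.add_comm, iter_add, Nat.mul_comm, iter_periodic; [reflexivity|].
      apply Hid; lra. }
    rewrite E; unfold h; simpl; destruct Rle_dec; lra.
Qed.

(** If no subinterval wanders, none is free of periodic points; two periodic points then have a
    common period, and that iterate is the identity between them. *)
Lemma finite_futures_somewhere F c d : continuity F -> bounded_indep F -> c < d ->
  exists u v, c < u /\ u < v /\ v < d /\ finite_futures F u v.
Proof.
  intros HF HB Hcd.
  destruct (classic (exists u v, c < u /\ u < v /\ v < d /\ wandering F u v))
    as [(u & v & Hu & Huv & Hv & Hw)|Hno].
  { exists u, v; repeat split; auto using wandering_finite_futures. }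
  assert (Hd : periodic_dense F c d).
  { intros u v Hu Huv Hv; apply NNPP; intros H.
    destruct (periodic_free_wandering F u v HF Huv) as (u' & v' & Hw).
    - intros n x Hn Hx E; apply H; eauto.
    - apply Hno; exists u', v'; intuition lra. }
  destruct (Hd ((5 * c + d) / 6) ((4 * c + 2 * d) / 6)) as (n & p & Hn & Hp & Ep); [lra..|].
  destruct (Hd ((2 * c + 4 * d) / 6) ((c + 5 * d) / 6)) as (m & q & Hm & Hq & Eq); [lra..|].
  exists p, q; repeat split; [lra..|].
  apply (identity_finite_futures F (m * n)); [nia | lra |].
  apply periodic_dense_identity; auto; [|nia| |].
  - intros u v Hu Huv Hv; apply Hd; lra.
  - now apply iter_periodic.
  - rewrite Nat.mul_comm; now apply iter_periodic.
Qed.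

(** * Counting names *)

Lemma strongly_sorted_app_inv (l1 l2 : list nat) : StronglySorted lt (l1 ++ l2) ->
  StronglySorted lt l1 /\ StronglySorted lt l2.
Proof.
  induction l1 as [|a l1 IH]; simpl; intros H; [split; [constructor | exact H]|].
  apply StronglySorted_inv in H as [H Ha]; destruct (IH H) as [H1 H2].
  apply Forall_app in Ha as [Ha _]; split; [constructor|]; assumption.
Qed.

Section Gap.

Variables (F : R -> R) (u v : R) (D : nat) (Rho : list (nat -> bool)).
Hypothesis no_indep : forall ss, StronglySorted lt ss -> length ss = D -> ~ indep F u v ss.
Hypothesis futures : forall y, u < y < v -> exists rho, In rho Rho /\
  forall s, if rho s then u <= iter F s y else iter F s y <= v.

Definition fits (x : R) : list nat -> list bool -> Prop :=
  Forall2 (fun t b => if b : bool then u <= iter F t x else iter F t x <= v).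

(** A set of [D] times shattered by the gap-avoiding patterns would be an independence set, so
    Sauer-Shelah leaves only the polynomial alternative. *)
Lemma gap_avoiding_words ts : u < v -> StronglySorted lt ts ->
  exists S, (length S <= (length ts + 1) ^ D)%nat /\
    forall x, (forall t, In t ts -> ~ (u < iter F t x < v)) ->
      exists w, In w S /\ fits x ts w.
Proof.
  intros Huv Hts.
  set (P := fun x t (b : bool) => if b then v <= iter F t x else iter F t x <= u).
  destruct (sauer_shelah ts D (fun w => exists x, Forall2 (P x) ts w))
    as [(S & HS & HL)|(ss & H1 & _ & H3 & H4)].
  - exists S; split; [exact HL|]; intros x Hx.
    assert (Hw : Forall2 (P x) ts
      (map (fun t => if Rle_dec v (iter F t x) then true else false) ts)).
    { apply Forall2_map_r; clear - Hx; induction ts as [|t ts IH]; constructor.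
      - specialize (Hx t (or_introl eq_refl)); unfold P; destruct Rle_dec; lra.
      - apply IH; intros; apply Hx; now right. }
    eexists; split; [apply HS; [now rewrite length_map | exists x; exact Hw]|].
    revert Hw; apply Forall2_impl; intros t []; unfold P; lra.
  - exfalso; apply (no_indep ss (H3 Hts) H1); intros w Hw.
    destruct (H4 w) as (w' & _ & (x & Hx) & Hr); [lia|].
    exists x; exact (Hr _ Hx).
Qed.

(* Before its first visit to the gap [(u,v)] a point follows a gap-avoiding word; afterwards one of the finitely many futures. *)
Lemma gap_visiting_words pre : u < v -> forall post, StronglySorted lt (pre ++ post) ->
  exists S, (length S <= length pre * ((length pre + 1) ^ D * length Rho))%nat /\
    forall x, (exists t, In t pre /\ u < iter F t x < v) ->
      exists w, In w S /\ fits x (pre ++ post) w.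
Proof.
  (* The last time [t] of [pre] moves to [post]: either an earlier time already visits the gap, or
     the first visit is at [t]. *)
  intros Huv; induction pre as [|t pre IH] using rev_ind; intros post Hs.
  { exists nil; split; [simpl; lia|]; intros x (t & [] & _). }
  rewrite <- app_assoc in Hs; simpl in Hs.
  destruct (IH _ Hs) as (S1 & L1 & H1).
  apply strongly_sorted_app_inv in Hs as [Hpre Hpost].
  destruct (gap_avoiding_words pre Huv Hpre) as (S2 & L2 & H2).
  (* New words: a gap-avoiding word on [pre], then a future read with its clock started at [t]. *)
  exists (S1 ++ map (fun pr : list bool * (nat -> bool) =>
            fst pr ++ map (fun t' => snd pr (t' - t)%nat) (t :: post)) (list_prod S2 Rho)).
  split.
  - rewrite !length_app, length_map, length_prod; simpl.
    set (m := length pre) in *.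
    assert ((m + 1) ^ D <= (m + 1 + 1) ^ D)%nat by (apply Nat.pow_le_mono_l; lia).
    apply (Nat.mul_le_mono_r _ _ (length Rho)) in L2.
    apply (Nat.mul_le_mono_r _ _ (length Rho)) in H.
    nia.
  - intros x (t' & Ht' & Hx); rewrite <- app_assoc; simpl.
    destruct (classic (exists t, In t pre /\ u < iter F t x < v)) as [Hin|Hout].
    { destruct (H1 x Hin) as (w & Hw & Hfit); exists w; rewrite in_app_iff; auto. }
    apply in_app_iff in Ht' as [Ht'|[<-|[]]]; [exfalso; eauto|].
    destruct (H2 x) as (p & Hp & Hfit).
    { intros r Hr Hrx; apply Hout; eauto. }
    destruct (futures _ Hx) as (rho & Hrho & Hfut).
    exists (p ++ map (fun t' => rho (t' - t)%nat) (t :: post)); split.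
    + apply in_app_iff; right.
      apply (in_map (fun pr : list bool * (nat -> bool) =>
        fst pr ++ map (fun t' => snd pr (t' - t)%nat) (t :: post)) _ (p, rho)).
      now apply in_prod.
    + apply Forall2_app; [exact Hfit|]; apply Forall2_map_r.
      apply StronglySorted_inv in Hpost as [_ Hpost].
      assert (Hle : Forall (le t) (t :: post)).
      { constructor; [lia|]; revert Hpost; apply Forall_impl; intros; lia. }
      clear - Hle Hfut; induction Hle as [|r l Hr _ IH]; constructor; [|exact IH].
      specialize (Hfut (r - t)%nat); rewrite <- iter_add, Nat.sub_add in Hfut by exact Hr.
      exact Hfut.
Qed.

End Gap.

Lemma gap_words F c d : continuity F -> bounded_indep F -> c < d ->
  exists K q : nat, forall ts, StronglySorted lt ts ->
    exists S, (length S <= K * (length ts + 1) ^ q)%nat /\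
      forall x, exists w, In w S /\
        Forall2 (fun t b => if b : bool then c < iter F t x else iter F t x < d) ts w.
Proof.
  intros HF HB Hcd.
  destruct (finite_futures_somewhere F c d HF HB Hcd) as (u & v & Hu & Huv & Hv & Rho & HRho).
  destruct (HB u v Huv) as (D & HD).
  (* Avoiding words number at most (m+1)^D and visiting words at most m (m+1)^D times
     [length Rho]. *)
  exists (length Rho + 1)%nat, (S D); intros ts Hts.
  destruct (gap_avoiding_words F u v D HD ts Huv Hts) as (S1 & L1 & H1).
  destruct (gap_visiting_words F u v D Rho HD HRho ts Huv nil) as (S2 & L2 & H2);
    [now rewrite app_nil_r|]; rewrite app_nil_r in H2.
  exists (S1 ++ S2); split.
  - rewrite length_app; simpl.
    set (m := length ts) in *; set (P := ((m + 1) ^ D)%nat) in *; nia.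
  - intros x.
    assert (exists w, In w (S1 ++ S2) /\ fits F u v x ts w) as (w & Hw & Hfit).
    { destruct (classic (exists t, In t ts /\ u < iter F t x < v)) as [Hin|Hout].
      - destruct (H2 x Hin) as (w & Hw & Hfit); exists w; rewrite in_app_iff; auto.
      - destruct (H1 x) as (w & Hw & Hfit); [intros r Hr Hrx; apply Hout; eauto|].
        exists w; rewrite in_app_iff; auto. }
    exists w; split; [exact Hw|].
    revert Hfit; apply Forall2_impl; intros t []; lra.
Qed.

Lemma incr_upto_lt t n : incr_upto t n -> forall i j, (i < j)%nat -> (j < n)%nat ->
  (t i < t j)%nat.
Proof.
  intros Ht i j Hij Hj; induction Hij as [|j Hij IH].
  - now apply Ht.
  - specialize (Ht j Hj); specialize (IH ltac:(lia)); lia.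
Qed.

Lemma incr_upto_sorted t n : incr_upto t n -> StronglySorted lt (map t (seq 0 n)).
Proof.
  intros Ht.
  enough (forall m j, (j + m <= n)%nat -> StronglySorted lt (map t (seq j m))) as H
    by (apply H; lia).
  induction m as [|m IH]; intros j Hm; simpl; constructor.
  - apply IH; lia.
  - apply Forall_forall; intros s Hs; apply in_map_iff in Hs as (i & <- & Hi).
    apply in_seq in Hi; apply (incr_upto_lt t n Ht); lia.
Qed.

(** A name is constrained only while the orbit is below [z]: vacuous on I at [z = 0], and a subcover
    of the join once [z > 1]. *)
Definition poly_names_below (F : R -> R) (k : nat) (U : nat -> R -> Prop) (z : R) : Prop :=
  exists K q : nat, forall n t, incr_upto t n ->
    exists S : list (nat -> nat), (length S <= K * (n + 1) ^ q)%nat /\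
      (forall g, In g S -> join_idx k n g) /\
      forall x, I x -> exists g, In g S /\
        forall i, (i < n)%nat -> iter F (t i) x < z -> U (g i) (iter F (t i) x).

(** Each name is overlaid with a gap word: at [true] the orbit is above [c], so [U j] serves below
    [b]; at [false] it is below [d], where the old name is correct. The counts multiply. *)
Lemma poly_names_extend F k U j c d b : continuity F -> bounded_indep F ->
  (forall t x, I x -> I (iter F t x)) -> (j < k)%nat -> c < d ->
  (forall y, I y -> c < y < b -> U j y) ->
  poly_names_below F k U d -> poly_names_below F k U b.
Proof.
  intros HF HB HI Hj Hcd HU (K1 & q1 & H1).
  destruct (gap_words F c d HF HB Hcd) as (K2 & q2 & H2).
  exists (K1 * K2)%nat, (q1 + q2)%nat; intros n t Ht.
  destruct (H1 n t Ht) as (S1 & L1 & J1 & C1).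
  destruct (H2 _ (incr_upto_sorted t n Ht)) as (S2 & L2 & C2).
  rewrite length_map, length_seq in L2.
  exists (map (fun gw : (nat -> nat) * list bool =>
    fun i => if nth i (snd gw) false then j else fst gw i) (list_prod S1 S2)).
  split; [|split].
  - rewrite length_map, length_prod, Nat.pow_add_r.
    assert (H := Nat.mul_le_mono _ _ _ _ L1 L2); nia.
  - intros h Hh i Hi; apply in_map_iff in Hh as ((g & w) & <- & Hg).
    apply in_prod_iff in Hg as [Hg _]; simpl.
    destruct nth; [exact Hj | exact (J1 g Hg i Hi)].
  - intros x Hx; destruct (C1 x Hx) as (g & Hg & Cg); destruct (C2 x) as (w & Hw & Cw).
    eexists; split; [apply in_map, in_prod; eassumption|].
    intros i Hi Hb; simpl.
    apply Forall2_map_l, (Forall2_nth_iff _ 0%nat false) in Cw as [_ Cw].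
    rewrite length_seq in Cw; specialize (Cw i Hi); rewrite seq_nth in Cw by exact Hi.
    simpl in Cw; destruct nth.
    + apply HU; [apply HI, Hx | lra].
    + apply Cg; [exact Hi | exact Cw].
Qed.

(** If all good [z] were at most 1, their supremum would lie in some [U j] with a margin [e], and
    [poly_names_extend] would pass beyond it. *)
Lemma poly_names F k U : continuity F -> bounded_indep F ->
  (forall t x, I x -> I (iter F t x)) -> open_cover k U ->
  exists z, 1 < z /\ poly_names_below F k U z.
Proof.
  intros HF HB HI [HUo HUc].
  assert (H0 : poly_names_below F k U 0).
  { exists 1%nat, 0%nat; intros n t Ht; exists ((fun _ => 0%nat) :: nil).
    split; [simpl; lia|]; split.
    - intros g [<-|[]] i _; destruct (HUc 0) as (j & Hj & _); [unfold I; lra | lia].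
    - intros x Hx; eexists; split; [left; reflexivity|].
      intros i _ H; destruct (HI (t i) x Hx); lra. }
  apply NNPP; intros Hno.
  assert (Hle : forall z, poly_names_below F k U z -> z <= 1).
  { intros z Hz; apply Rnot_lt_le; intros H; apply Hno; eauto. }
  destruct (completeness (poly_names_below F k U)) as (z0 & Hub & Hlub);
    [exists 1; exact Hle | eauto |].
  assert (Hz0 : I z0) by (split; [exact (Hub 0 H0) | exact (Hlub 1 Hle)]).
  destruct (HUc z0 Hz0) as (j & Hj & HUj).
  destruct (HUo j Hj z0 Hz0 HUj) as (e & He & HUe).
  assert (exists z, poly_names_below F k U z /\ z0 - e < z) as (z & Hz & Hze).
  { apply NNPP; intros H; assert (z0 <= z0 - e); [|lra].
    apply Hlub; intros z Hz; apply Rnot_lt_le; intros H'; eauto. }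
  assert (z0 + e <= z0); [|lra].
  apply Hub, (poly_names_extend F k U j (z0 - e) z); auto.
  intros y Hy Hyz; apply HUe; [exact Hy | apply Rabs_def1; lra].
Qed.

Lemma pstar_attained f k U n : in_CII f -> open_cover k U ->
  exists t, incr_upto t n /\ pstar f k U n = Njoin f k U t n.
Proof.
  intros Hf HU.
  destruct (greatest_nat (fun m => exists t, incr_upto t n /\ Njoin f k U t n = m)
              (k ^ n) (Njoin f k U (fun i => i) n)) as (m & Hm & Hmax).
  - exists (fun i => i); split; [intros i _; lia | reflexivity].
  - intros m (t & _ & <-); apply (Ncov_spec _ _ _ (join_subcover f k U t n Hf HU)).
  - destruct (epsilon_spec (inhabits 0%nat)
      (fun m => (exists t, incr_upto t n /\ Njoin f k U t n = m) /\
         forall t, incr_upto t n -> (Njoin f k U t n <= m)%nat)) as [(t & Ht & E) _].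
    { exists m; split; [exact Hm|]; intros t Ht; apply Hmax; eauto. }
    exists t; split; [exact Ht | symmetry; exact E].
Qed.

Theorem mainTheorem19 (f : R -> R) (Hf : in_CII f) (Hnull : null f) :
  forall (k : nat) (U : nat -> R -> Prop), open_cover k U ->
  exists (C : R) (q : nat), 0 < C /\
    forall n : nat, (1 <= n)%nat -> INR (pstar f k U n) <= C * (INR n) ^ q.
Proof.
  intros k U HU.
  assert (HI : forall t x, I x -> I (iter (extend f) t x)).
  { intros t x Hx; rewrite iter_extend by assumption; now apply iter_I. }
  destruct (poly_names (extend f) k U (extend_continuity f Hf)
              (null_bounded_indep f Hf Hnull) HI HU) as (z & Hz & K & q & H).
  (* For [n >= 1], (n+1)^q <= (2n)^q; [K + 1] makes the constant positive. *)
  exists (INR (K + 1) * 2 ^ q), q; split.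
  { apply Rmult_lt_0_compat; [apply lt_0_INR; lia | apply pow_lt; lra]. }
  intros n Hn.
  destruct (pstar_attained f k U n Hf HU) as (t & Ht & ->).
  destruct (H n t Ht) as (S & HL & HJ & HC).
  assert (HN : (Njoin f k U t n <= K * (n + 1) ^ q)%nat).
  { eapply Nat.le_trans; [|exact HL]; apply Ncov_spec.
    exists S; split; [split; [exact HJ|] | apply le_n].
    intros x Hx; destruct (HC x Hx) as (g & Hg & Cg).
    exists g; split; [exact Hg|]; split; [exact Hx|]; intros i Hi.
    specialize (Cg i Hi); rewrite iter_extend in Cg by assumption.
    apply Cg; destruct (iter_I f (t i) x Hf Hx); lra. }
  assert (HN2 : (Njoin f k U t n <= (K + 1) * (2 * n) ^ q)%nat).
  { eapply Nat.le_trans; [exact HN|]; apply Nat.mul_le_mono; [lia|].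
    apply Nat.pow_le_mono_l; lia. }
  apply le_INR in HN2; rewrite mult_INR, pow_INR, mult_INR in HN2.
  simpl (INR 2) in HN2; rewrite Rpow_mult_distr in HN2.
  replace (1 + 1) with 2 in HN2 by ring; lra.
Qed.
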